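(* Let $\kappa>0$ with $\bar E^\top\bar E=\kappa Q\succ0$. Let $s=\dim(\mathcal R(\bar E)\cap\mathcal R(\bar F))$, let $\lambda_1\le\dots\le\lambda_n$ be the generalized eigenvalues of $\left(\bar E^\top(2\Pi_{\mathcal R(\bar F)}-I)\bar E,\ \bar E^\top\bar E\right)$, and let $|\phi_{2n-s}|=|\phi_{2n-s}(\alpha,\beta)|$ be the convergence factor of the ADMM iterates, i.e. the $(2n-s)$-th smallest magnitude among the eigenvalues of the ADMM transition matrix $M$, regarded as a function of the relaxation parameter $\alpha$ and of $\beta=\rho\kappa/(1+\rho\kappa)$. The parameters $\alpha^\star$ and $\beta^\star$ that minimize $|\phi_{2n-s}|$ over $\alpha\in(0,\alpha^\star]$ and $\beta\in(0,1)$, and the resulting value of $|\phi_{2n-s}|$, are as follows. Case I: if $\lambda_{n-s}>0$ and $\lambda_{n-s}\ge|\lambda_1|$, then $$\beta^\star=\frac{1-\sqrt{1-\lambda_{n-s}^2}}{\lambda_{n-s}^2},\qquad \alpha^\star=2,\qquad |\phi_{2n-s}|=\frac{1-\sqrt{1-\lambda_{n-s}^2}}{\lambda_{n-s}}.$$ Case II: if $|\lambda_1|>\lambda_{n-s}>0$, then $$\beta^\star=\frac{1-\sqrt{1-\lambda_{n-s}^2}}{\lambda_{n-s}^2},\qquad \alpha^\star=\frac{4}{2-\left(\lambda_{n-s}+\lambda_1-\sqrt{\lambda_1^2-\lambda_{n-s}^2}\right)\beta^\star},\qquad |\phi_{2n-s}|=1+\frac{\alpha^\star}{2}\lambda_{n-s}\beta^\star-\frac{\alpha^\star}{2}.$$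 Case III: if $0\ge\lambda_{n-s}\ge\lambda_1$, then $$\beta^\star=\frac12,\qquad \alpha^\star=\frac{4}{2-\lambda_1},\qquad |\phi_{2n-s}|=\frac{-\lambda_1}{2-\lambda_1}.$$
   Context: Setting. $Q\in\mathbf R^{n\times n}$ is symmetric with $Q\succ0$, $q\in\mathbf R^n$, $c\in\mathbf R^m$; $E\in\mathbf R^{p\times n}$ and $F\in\mathbf R^{p\times m}$ have full column rank; $R\in\mathbf R^{r\times p}$; $\bar E=RE$, $\bar F=RF$. The problem is to minimize $\tfrac12x^\top Qx+q^\top x+c^\top z$ over $(x,z)\in\mathbf R^n\times\mathbf R^m$ subject to $\bar Ex+\bar Fz=0$ (the right-hand side is normalized to $0$). It is assumed that every $v=Ex+Fz$ with $Rv=0$ satisfies $v=0$ (so $\bar E,\bar F$ have full column rank), and that the feasible set contains a nonzero point (so $s\ge1$); $s<n$, so that $\lambda_{n-s}$ is defined. $\mathcal R(\cdot)$, $\mathcal N(\cdot)$ denote range and null-space, $\Pi_{\mathcal S}$ the orthogonal projector onto the subspace $\mathcal S$. A generalized eigenvalue of $(B,D)$, $D$ invertible, is $\lambda$ with $(B-\lambda D)v=0$ for some $v\ne0$; here they are real and counted with multiplicity. For a step-size $\rho>0$ and relaxation parameter $\alpha\in(0,2]$, the ADMM iterates in terms of $x^{k+1}$ and $y^k=\bar E^\top\bar Fz^k$ obey $\begin{bmatrix} x^{k+1} \\ y^k \end{bmatrix}=M\begin{bmatrix} x^{k} \\ y^{k-1} \end{bmatrix}$, with $M=\begin{bmatrix}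 M_{11} & M_{12} \\ M_{21} & (1-\alpha)I \end{bmatrix}\in\mathbf R^{2n\times2n}$, $$M_{11}=\alpha\rho(Q+\rho\bar E^\top\bar E)^{-1}\bar E^\top(2\Pi_{\mathcal R(\bar F)}-I)\bar E+I,\quad M_{12}=\alpha\rho(Q+\rho\bar E^\top\bar E)^{-1},\quad M_{21}=-\alpha\bar E^\top\Pi_{\mathcal R(\bar F)}\bar E.$$ The eigenvalues of $M$ are ordered $|\phi_1|\le\dots\le|\phi_{2n}|$ with multiplicity. When $\bar E^\top\bar E=\kappa Q$, $M$ depends on $\rho$ only through $\beta=\rho\kappa/(1+\rho\kappa)\in(0,1)$. *)

(* Defs.v *)
From mathcomp Require Import all_boot all_order all_algebra.
From mathcomp Require Import reals.
From mathcomp Require Import complex ring.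

Set Implicit Arguments.
Unset Strict Implicit.
Unset Printing Implicit Defensive.

Import Order.TTheory GRing.Theory Num.Theory.

Local Open Scope ring_scope.

Section LinearAlgebra.
Variable R : realType.

Definition posdef n (Q : 'M[R]_n) : Prop :=
  Q^T = Q /\ forall x : 'cV[R]_n, x != 0 -> 0 < (x^T *m Q *m x) 0 0.

(* MathComp subspaces are row spaces, so the range of [B] is [B^T] and its
   orthogonal complement [{u | u *m B = 0}] is [kermx B].  The outer transpose
   turns the projection of row vectors into one acting on columns from the left. *)
Definition orth_proj p m (B : 'M[R]_(p, m)) : 'M[R]_p :=
  (proj_mx <<B^T>>%MS (kermx B))^T.

Definition dim_range_cap p n m (A : 'M[R]_(p, n)) (B : 'M[R]_(p, m)) : nat :=
  \rank (A^T :&: B^T)%MS.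

Definition gen_eigenvalue n (B D : 'M[R]_n) (x : R) : Prop :=
  exists2 v : 'cV[R]_n, v != 0 & (B - x *: D) *m v = 0.

Definition gen_char_poly n (B D : 'M[R]_n) : {poly R} :=
  \det (map_mx polyC B - 'X *: map_mx polyC D).

(* [lam] lists, in nondecreasing order and with multiplicity, the generalized
   eigenvalues of [(B, D)], all of which are real; meant for invertible [D]. *)
Definition gen_eigenvalues n (B D : 'M[R]_n) (lam : n.-tuple R) : Prop :=
  sorted <=%R lam /\
  gen_char_poly B D = (\det D)%:P * \prod_(x <- lam) (x%:P - 'X).

Definition eigenvalues k (A : 'M[R]_k) : seq R[i] :=
  sval (closed_field_poly_normal (char_poly (map_mx (real_complex R) A))).

Definition eigenvalue_magnitudes k (A : 'M[R]_k) : seq R :=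
  sort <=%R [seq Normc.normc z | z <- eigenvalues A].

(* The [k]-th entry, counted from 1. *)
Definition entry (s : seq R) (k : nat) : R := s`_k.-1.

Lemma orth_cap p m (B : 'M[R]_(p, m)) : (<<B^T>> :&: kermx B)%MS = 0.
Proof.
apply/eqP/rowV0P => u; rewrite sub_capmx genmxE => /andP[/submxP[w uE]].
rewrite sub_kermx => /eqP uB0.
have : u *m u^T = 0 by rewrite {1}uE -mulmxA -trmx_mul uB0 trmx0 mulmx0.
move=> /matrixP/(_ 0 0); rewrite !mxE => /eqP.
rewrite psumr_eq0 => [/allP u0|i _]; last by rewrite mxE -expr2 sqr_ge0.
apply/rowP => i; move: (u0 i (mem_index_enum i)).
by rewrite mxE -expr2 sqrf_eq0 => /eqP ->; rewrite mxE.
Qed.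

Lemma orth_sum p m (B : 'M[R]_(p, m)) : (1%:M <= <<B^T>> + kermx B)%MS.
Proof.
rewrite sub1mx /row_full; have := mxrank_sum_cap <<B^T>>%MS (kermx B).
rewrite orth_cap mxrank0 addn0 => ->.
by rewrite genmxE mxrank_tr mxrank_ker subnKC // rank_leq_row.
Qed.

Lemma orth_projP p m (B : 'M[R]_(p, m)) (P := orth_proj B) :
  [/\ P *m P = P, P^T = P & (P^T :=: B^T)%MS].
Proof.
set P0 := proj_mx <<B^T>>%MS (kermx B).
have PE : P = P0^T by [].
have idP0 : P0 *m P0 = P0 by apply: proj_mx_proj; exact: orth_cap.
have /submxP[X P0E] : (P0 <= B^T)%MS.
  by rewrite -[P0]mul1mx -(genmxE B^T) proj_mx_sub.
have kerP0 : (1%:M - P0) *m B = 0.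
  by apply/eqP; rewrite -sub_kermx -{1}[P0]mul1mx proj_mx_compl_sub ?orth_sum.
have symP0 : P0^T = P0.
  have : (1%:M - P0) *m P0^T = 0.
    by rewrite P0E trmx_mul -P0E trmxK mulmxA kerP0 mul0mx.
  rewrite mulmxBl mul1mx => /subr0_eq P0tE.
  by rewrite P0tE -[LHS]trmxK trmx_mul trmxK -P0tE trmxK.
rewrite PE symP0; split=> //; rewrite ?symP0 //.
apply/eqmxP/andP; split; first by rewrite P0E submxMl.
rewrite -[X in (X <= _)%MS](proj_mx_id (orth_cap B)) ?genmxE //.
exact: submxMl.
Qed.

Lemma mem_gen_eigenvalues n (B D : 'M[R]_n) (lam : n.-tuple R) (x : R) :
  D \in unitmx -> gen_eigenvalues B D lam -> x \in lam <-> gen_eigenvalue B D x.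
Proof.
rewrite unitmxE unitfE => D0 [_ /(congr1 (horner^~ x))].
rewrite hornerM hornerC horner_prod /gen_char_poly -[LHS]/(horner_eval x _).
rewrite -det_map_mx; set C := map_mx _ _.
have -> : C = B - x *: D.
  by apply/matrixP => i j; rewrite !mxE /= /horner_eval !hornerE.
move=> detE; have -> : (x \in lam) = (\det (B - x *: D) == 0).
  rewrite detE mulf_eq0 (negPf D0) /= prodf_seq_eq0.
  apply/idP/hasP => [xl|[y yl /=]]; first by exists x; rewrite ?hornerE ?subrr.
  by rewrite !hornerE subr_eq0 => /eqP <-.
rewrite -det_tr; split=> [/det0P[v v0 vE]|[v v0 vE]].
  by exists v^T; rewrite ?trmx_eq0 //; apply: trmx_inj;
     rewrite trmx_mul trmxK vE trmx0.
by apply/det0P; exists v^T; rewrite ?trmx_eq0 // -trmx_mul vE trmx0.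
Qed.

Lemma eigenvaluesP k (A : 'M[R]_k) :
  char_poly (map_mx (real_complex R) A) = \prod_(z <- eigenvalues A) ('X - z%:P).
Proof.
rewrite /eigenvalues; case: closed_field_poly_normal => r /= {1}->.
by rewrite (monicP (char_poly_monic _)) scale1r.
Qed.

End LinearAlgebra.

Section ADMM.
Variable R : realType.

Definition admm_matrix n m r (Q : 'M[R]_n) (Eb : 'M[R]_(r, n))
    (Fb : 'M[R]_(r, m)) (alpha rho : R) : 'M[R]_(n + n) :=
  let P := orth_proj Fb in
  let K := invmx (Q + rho *: (Eb^T *m Eb)) in
  block_mx
    ((alpha * rho) *: (K *m Eb^T *m (2%:R *: P - 1%:M) *m Eb) + 1%:M)
    ((alpha * rho) *: K)
    (- alpha *: (Eb^T *m P *m Eb))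
    (1 - alpha)%:M.

(* [|phi_(2n-s)|] as a function of [alpha] and [rho]. *)
Definition admm_factor n m r (Q : 'M[R]_n) (Eb : 'M[R]_(r, n))
    (Fb : 'M[R]_(r, m)) (alpha rho : R) : R :=
  entry (eigenvalue_magnitudes (admm_matrix Q Eb Fb alpha rho))
        (2 * n - dim_range_cap Eb Fb).

(* The step-size [rho] with [beta = rho * kappa / (1 + rho * kappa)]. *)
Definition step_of_beta (kappa beta : R) : R := beta / (kappa * (1 - beta)).

Lemma step_of_betaP (kappa beta rho : R) : 0 < kappa ->
  (0 < beta < 1) && (rho == step_of_beta kappa beta) =
  (0 < rho) && (beta == rho * kappa / (1 + rho * kappa)).
Proof.
move=> k0; rewrite /step_of_beta.
apply/andP/andP => [[/andP[b0 b1] /eqP->]|[r0 /eqP->]].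
  have b1' : 1 - beta != 0 by rewrite lt0r_neq0 ?subr_gt0.
  split; first by rewrite divr_gt0 ?mulr_gt0 ?subr_gt0.
  have k0' := lt0r_neq0 k0.
  by apply/eqP; field; rewrite ?k0' ?b1' //= subrK oner_neq0.
have d0 : 0 < 1 + rho * kappa by rewrite addr_gt0 ?mulr_gt0.
have d0' := lt0r_neq0 d0; have k0' := lt0r_neq0 k0.
split; first by rewrite divr_gt0 ?mulr_gt0 //= ltr_pdivrMr // mul1r ltrDr.
by apply/eqP; field; rewrite ?d0' ?k0' //= addrK oner_neq0.
Qed.

(* The relaxation parameter lies in [(0, 2]]; [amax] further restricts it. *)
Definition param_domain (amax alpha beta : R) : Prop :=
  [/\ 0 < alpha <= 2%:R, alpha <= amax & 0 < beta < 1].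

Definition is_minimizer (D : R -> R -> Prop) (f : R -> R -> R) (a b : R) : Prop :=
  D a b /\ forall alpha beta, D alpha beta -> f a b <= f alpha beta.

(* [(a, b)] is the minimizer of [f] over [(0, a] * (0, 1)], with value [v]; the
   upper end of the range of [alpha] is the optimal [a] itself. *)
Definition optimal_params (f : R -> R -> R) (a b v : R) : Prop :=
  (forall alpha beta,
     is_minimizer (param_domain a) f alpha beta <-> alpha = a /\ beta = b) /\
  f a b = v.

End ADMM.

(* Main.v *)
Require Import Defs.
From mathcomp Require Import all_boot all_order all_algebra.
From mathcomp Require Import reals.
From mathcomp Require Import complex ring lra.

Set Implicit Arguments.
Unset Strict Implicit.
Unset Printing Implicit Defensive.

Import Order.TTheory GRing.Theory Num.Theory.

Local Open Scope ring_scope.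

(** Put G = Eb^T Eb, B = Eb^T (2 P - 1) Eb with P the projector onto the range
    of Fb, and T = G^-1 B.  Since G is a multiple of Q, every block of the ADMM
    matrix is, up to the change of variable y -> G^-1 y, a polynomial of degree
    at most one in T; the matrix therefore splits into 2 x 2 modes, one for
    each generalized eigenvalue l, with characteristic polynomial
    X^2 - (2 - a + a b l) X + (1 - a + a b l + a^2 b (1 - l) / 2)
    ([char_poly_admm_block]).

    The identities G - B = 2 Eb^T (1 - P) Eb and G + B = 2 Eb^T P Eb, whose
    right-hand sides are twice Gram matrices, put every l in [-1, 1].  The
    kernel of the first one is mapped by Eb onto the intersection of the two
    ranges, so that l = 1 has multiplicity exactly s
    ([reflection_eigenvalues_split]).  The s modes with l = 1 have roots 1 and
    1 - a (1 - b), and all the other roots lie in the closed unit disc.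
    Discarding s roots equal to 1, which are of largest modulus, identifies
    |phi_(2n-s)| as the maximum of |1 - a (1 - b)| and of the spectral radii of
    the modes with l < 1 ([admm_factor_le]).

    The roots of a real quadratic lie in the disc of radius t if and only if
    four polynomial inequalities hold ([roots_in_disc], [root_pair_in_disc]);
    this removes all square roots and the distinction between real and complex
    roots.  With u = 1 - t and w = u / a, the value of a mode at t is a^2 times
    w^2 - w (1 - b l) + b (1 - l) / 2, a quadratic in w that is free of a.

    When lambda_(n-s) = l > 0, the value beta* gives that mode a double root
    1 - a w.  Any other choice of b, or a smaller value of a, makes the radius
    of this single mode larger: complex roots have modulus sqrt(det), which
    increases with b, and for smaller b the larger real root moves out
    ([double_root_unique]).  The mode of lambda_1 only limits a: all values up
    to 2 are allowed if |lambda_1| <= l, and otherwise those up to the point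
    where its smaller root reaches -(1 - a w) ([double_root_attained]).  When
    lambda_(n-s) <= 0, the root 1 - a (1 - b) takes over from the double root:
    any mode with l < 1 forces b >= 1/2, this root forces b <= 1/2, and at
    b = 1/2 it equals 1 - a / 2, which decreases with a ([half_unique],
    [half_attained]). *)

(** * Quadratics with both roots in a disc *)

Section Modes.
Variable R : realFieldType.
Implicit Types a b l t : R.

(** These inequalities say that X^2 - tau X + delta has both roots in the disc
    of radius t.  The Schur-Cohn conditions |delta| <= t^2 and
    |tau| t <= t^2 + delta do not suffice for t = 0, a value which is attained
    below.  A nonnegative value at t leaves both or none of two real roots
    beyond t; the bound on tau excludes the former. *)
Definition roots_in_disc (tau delta t : R) : Prop :=
  [/\ `|tau| <= 2 * t, delta <= t ^+ 2,
      0 <= t ^+ 2 - tau * t + delta & 0 <= t ^+ 2 + tau * t + delta].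

(** Trace and determinant of the 2 x 2 block of the generalized eigenvalue l. *)
Definition mode_trace a b l : R := 2 - a + a * b * l.

Definition mode_det a b l : R :=
  1 - a + a * b * l + a ^+ 2 * b * (1 - l) / 2.

Definition mode_in_disc a b l t : Prop :=
  roots_in_disc (mode_trace a b l) (mode_det a b l) t.

(** Each condition is affine in b, and the two ends b = 0 and b = 1 are settled
    by 0 < a <= 2 and -1 <= l <= 1. *)
Lemma mode_in_unit_disc a b l :
  0 < a <= 2 -> 0 < b < 1 -> -1 <= l <= 1 -> mode_in_disc a b l 1.
Proof.
move=> /andP[a0 a2] /andP[b0 b1] /andP[l0 l1].
have ab0 : 0 <= a * b by rewrite mulr_ge0 ?ltW.
have ab1 : a * b <= a by rewrite ler_piMr ?ltW.
rewrite /mode_in_disc /mode_trace /mode_det; split.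
- by rewrite ler_norml; apply/andP; split; nra.
- suff : 0 <= a * (1 - b) + a * b * (1 - l) * (2 - a) / 2 by lra.
  rewrite addr_ge0 ?mulr_ge0 ?invr_ge0 ?subr_ge0 // ltW //.
- suff : 0 <= a * (a * b) * (1 - l) by lra.
  by rewrite !mulr_ge0 ?subr_ge0 // ltW.
- have h1 : 0 <= (1 - b) * (2 - a) by rewrite mulr_ge0 ?subr_ge0 // ltW.
  have h2 : 0 <= b * (2 - a) ^+ 2 by rewrite mulr_ge0 ?sqr_ge0 // ltW.
  have h3 : 0 <= a * b * (4 - a) * (1 + l) by rewrite !mulr_ge0 //; lra.
  by lra.
Qed.

End Modes.

Section Spectrum.
Variable R : realType.
Implicit Types (t tau delta : R) (s : seq R).

Lemma sqr_le_itv (x t : R) : 0 <= t -> (x ^+ 2 <= t ^+ 2) = (- t <= x <= t).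
Proof.
by move=> t0; rewrite -ler_norml -real_normK ?num_real // ler_sqr ?nnegrE.
Qed.

Lemma normc_le (z : R[i]) t : 0 <= t ->
  (Normc.normc z <= t) = (complex.Re z ^+ 2 + complex.Im z ^+ 2 <= t ^+ 2).
Proof.
case: z => x y t0 /=; rewrite -[X in _ <= X](ger0_norm t0) -sqrtr_sqr.
by rewrite ler_sqrt ?sqr_ge0.
Qed.

(** As z1 + z2 and z1 z2 are real, the roots are either both real or conjugate.
    In the real case the two evaluations are (t - z1) (t - z2) and
    (t + z1) (t + z2); a root beyond t would force the other one beyond t as
    well, against the bound on the sum.  In the conjugate case delta is the
    squared modulus. *)
Lemma root_pair_in_disc (z1 z2 : R[i]) tau delta t : 0 <= t ->
    z1 + z2 = real_complex R tau -> z1 * z2 = real_complex R delta ->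
  (Normc.normc z1 <= t /\ Normc.normc z2 <= t) <-> roots_in_disc tau delta t.
Proof.
case: z1 z2 => [x1 y1] [x2 y2] t0 [tauE y12] [deltaE im0].
have y2E : y2 = - y1 by lra.
subst y2; rewrite !normc_le //= /roots_in_disc -tauE -deltaE ler_norml.
have [y0|x12] : y1 = 0 \/ x2 = x1.
- have /eqP : y1 * (x2 - x1) = 0 by lra.
  by rewrite mulf_eq0 subr_eq0 => /orP[]/eqP; [left|right].
- rewrite y0 oppr0 expr0n /= !addr0 mulr0 subr0 !sqr_le_itv //.
  split=> [[/andP[? ?] /andP[? ?]]|[/andP[? ?] _ pos neg]].
    by split; [apply/andP; split; lra | nra | nra | nra].
  have p1 : 0 <= (t - x1) * (t - x2) by lra.
  have p2 : 0 <= (t + x1) * (t + x2) by lra.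
  by split; apply/andP; split; rewrite leNgt; apply/negP => ?; nra.
subst x2; rewrite sqrrN; split=> [[h _]|[_ h _ _]]; last by split; lra.
have /andP[? ?] : - t <= x1 <= t.
  by rewrite -sqr_le_itv //; apply: le_trans h; rewrite lerDl sqr_ge0.
have ? := sqr_ge0 y1.
by split; [apply/andP; split; lra | lra | nra | nra].
Qed.

Definition quad_poly tau delta : {poly R} := 'X^2 - tau *: 'X + delta%:P.

Lemma quad_factor (C : comNzRingType) (x y : C) :
  'X^2 - (x + y) *: 'X + (x * y)%:P = ('X - x%:P) * ('X - y%:P).
Proof. by rewrite -mul_polyC polyCD polyCM; ring. Qed.

Definition quad_roots tau delta : R[i] * R[i] :=
  let r := sqrtC (real_complex R (tau ^+ 2 - 4 * delta)) in
  ((real_complex R tau + r) / 2, (real_complex R tau - r) / 2).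

Lemma quad_roots_sum tau delta :
  (quad_roots tau delta).1 + (quad_roots tau delta).2 = real_complex R tau.
Proof. by rewrite /=; field. Qed.

Lemma quad_roots_prod tau delta :
  (quad_roots tau delta).1 * (quad_roots tau delta).2 = real_complex R delta.
Proof.
rewrite /=; set r := sqrtC _.
have rE : r ^+ 2 = real_complex R tau ^+ 2 - 4 * real_complex R delta.
  by rewrite sqrtCK rmorphB rmorphXn rmorphM /= rmorph_nat.
transitivity ((real_complex R tau ^+ 2 - r ^+ 2) / 4); first by field.
by rewrite rE; field.
Qed.

Lemma map_quad_poly tau delta :
  map_poly (real_complex R) (quad_poly tau delta)
  = ('X - (quad_roots tau delta).1%:P) * ('X - (quad_roots tau delta).2%:P).
Proof.
rewrite -quad_factor quad_roots_sum quad_roots_prod.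
by rewrite rmorphD rmorphB /= map_polyXn map_polyZ /= map_polyX map_polyC.
Qed.

(** * The largest magnitude after discarding ones *)

Lemma sorted_cat_nseq s k (x : R) : sorted <=%R s -> all (<= x) s ->
  sorted <=%R (s ++ nseq k x).
Proof.
move=> s_sorted s_le.
rewrite (sorted_pairwise le_trans) pairwise_cat -!(sorted_pairwise le_trans).
rewrite s_sorted /=; apply/andP; split; last first.
  by elim: k => [|[|j] IH] //=; rewrite lexx.
by apply/allrelP => y z /(allP s_le) yx; rewrite mem_nseq => /andP[_ /eqP ->].
Qed.

Lemma sorted_split_max s (x : R) : sorted <=%R s -> all (<= x) s ->
  s = [seq y <- s | y != x] ++ nseq (count_mem x s) x.
Proof.
move=> s_sorted s_le; apply: (sorted_eq le_trans le_anti) => //.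
  apply: sorted_cat_nseq; first exact: (sorted_filter le_trans).
  by apply/allP => y; rewrite mem_filter => /andP[_ /(allP s_le)].
rewrite -size_filter -(all_pred1P _ _ (filter_all (pred1 x) s)).
by rewrite perm_sym perm_catC (perm_filterC (pred1 x) s).
Qed.

(** The largest entry of s stays at position [size s] when entries equal to the
    upper bound 1 are appended. *)
Lemma entry_sort_cat_nseq_le s k t :
    s != [::] -> all (<= 1) s ->
  (entry (sort <=%R (s ++ nseq k 1)) (size s) <= t) = all (<= t) s.
Proof.
move=> s0 s1; set v := entry _ _.
have n0 : (0 < size s)%N by rewrite lt0n size_eq0.
have sortE : sort <=%R (s ++ nseq k 1) = sort <=%R s ++ nseq k 1.
  apply: (sorted_eq le_trans le_anti).
  - exact: (sort_sorted le_total).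
  - apply: sorted_cat_nseq; first exact: (sort_sorted le_total).
    by rewrite all_sort.
  - by rewrite perm_sort perm_cat2r perm_sym perm_sort.
have vE : v = (sort <=%R s)`_(size s).-1.
  by rewrite /v /entry sortE nth_cat size_sort prednK // leqnn.
have vs : v \in s by rewrite -(mem_sort <=%R) vE mem_nth // size_sort prednK.
apply/idP/idP => [vt|/allP]; last exact.
apply/allP => y; rewrite -(mem_sort <=%R) => ys; apply: le_trans vt.
rewrite -[y](nth_index 0 ys) vE.
have iy : (index y (sort <=%R s) < size s)%N.
  by rewrite -(size_sort <=%R) index_mem.
apply: (sorted_leq_nth le_trans lexx) => //.
- exact: (sort_sorted le_total).
- by rewrite inE size_sort.
- by rewrite inE size_sort prednK.
- by rewrite -ltnS prednK.
Qed.

(** When the spectrum consists of the roots of quadratics, k copies of c and k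
    copies of 1, all of modulus at most 1, the entry just before the k ones is
    the largest of the remaining moduli. *)
Lemma entry_magnitudes_le N (A : 'M[R]_N) (mu : seq R) (tr dt : R -> R) k c t :
    char_poly A = (\prod_(l <- mu) quad_poly (tr l) (dt l))
                  * ('X - c%:P) ^+ k * ('X - 1) ^+ k ->
    (0 < k)%N -> `|c| <= 1 ->
    (forall l, l \in mu -> roots_in_disc (tr l) (dt l) 1) ->
  entry (eigenvalue_magnitudes A) (2 * size mu + k) <= t <->
  `|c| <= t /\ forall l, l \in mu -> roots_in_disc (tr l) (dt l) t.
Proof.
move=> chE k0 c1 mu1.
pose zs l := quad_roots (tr l) (dt l).
pose pairs := flatten [seq [:: (zs l).1; (zs l).2] | l <- mu].
have eigE : perm_eq (eigenvalues A)
    (pairs ++ nseq k (real_complex R c) ++ nseq k 1).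
  apply: prod_XsubC_eq; rewrite -eigenvaluesP -map_char_poly chE !big_cat /=.
  rewrite !rmorphM !rmorphXn /= !rmorphB /= map_polyX map_polyC rmorph1 /=.
  rewrite !big_nseq -!Monoid.iteropE /= mulrA; congr (_ * _ * _).
  rewrite rmorph_prod big_flatten big_map; apply: eq_bigr => l _.
  by rewrite big_cons big_seq1; exact: map_quad_poly.
set s := [seq Normc.normc z | z <- pairs ++ nseq k (real_complex R c)].
have magE : eigenvalue_magnitudes A = sort <=%R (s ++ nseq k 1).
  have normc1 : Normc.normc (1 : R[i]) = 1 := Normc.normc1 R.
  apply/perm_sort_leP; rewrite (permPl (perm_map _ eigE)) /s catA map_cat.
  by rewrite map_nseq normc1.
have sizeE : size s = (2 * size mu + k)%N.
  rewrite size_map size_cat size_nseq; congr addn.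
  by rewrite /pairs; elim: (mu) => //= l m ->; rewrite mulnS.
have s_le u : all (<= u) s <->
    `|c| <= u /\ forall l, l \in mu -> roots_in_disc (tr l) (dt l) u.
  rewrite /s map_cat all_cat map_nseq all_nseq -leqn0 leqNgt k0 /=.
  rewrite expr0n addr0 sqrtr_sqr.
  split=> [/andP[/allP hp cu]|[cu hmu]].
    split=> // l lmu; have u0 := le_trans (normr_ge0 _) cu.
    apply/(root_pair_in_disc u0 (quad_roots_sum _ _) (quad_roots_prod _ _)).
    split; apply: hp; apply: map_f; apply/flatten_mapP; exists l => //;
      by rewrite !inE eqxx ?orbT.
  rewrite cu andbT; have u0 := le_trans (normr_ge0 _) cu.
  apply/allP => _ /mapP[z /flatten_mapP[l lmu zl] ->].
  have := hmu l lmu.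
  move/(root_pair_in_disc u0 (quad_roots_sum _ _) (quad_roots_prod _ _)).
  by case=> h1 h2; move: zl; rewrite !inE => /orP[]/eqP->.
rewrite magE -sizeE entry_sort_cat_nseq_le ?s_le //.
by rewrite -size_eq0 sizeE addn_eq0 negb_and -!lt0n k0 orbT.
Qed.

End Spectrum.

(** * The characteristic polynomial of the ADMM matrix *)

Section Pencil.
Variable R : realType.

Lemma poly_eq_off_point (p q : {poly R}) (c : R) :
  (forall x, x != c -> p.[x] = q.[x]) -> p = q.
Proof.
move=> pq; apply/eqP; rewrite -subr_eq0; apply/eqP.
have : (p - q) * ('X - c%:P) = 0.
  apply: (@roots_geq_poly_eq0 _ _
            [seq i%:R | i <- iota 0 (size ((p - q) * ('X - c%:P)))]).
  - apply/allP => x _; rewrite rootE !hornerE.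
    by have [->|/pq ->] := eqVneq x c; rewrite ?subrr ?mulr0 ?mul0r.
  - by rewrite map_inj_uniq ?iota_uniq // => i j /eqP; rewrite eqr_nat => /eqP.
  - by rewrite size_map size_iota.
by move/eqP; rewrite mulf_eq0 polyXsubC_eq0 orbF => /eqP.
Qed.

Lemma prod_const_tuple n (lam : n.-tuple R) (c : R) :
  \prod_(x <- lam) c = c ^+ n.
Proof. by rewrite big_const_seq count_predT size_tuple -Monoid.iteropE. Qed.

(** The homogeneous form of the generalized characteristic polynomial: for
    b != 0 it is that polynomial at a / b, scaled by (- b)^n. *)
Lemma det_pencil n (B D : 'M[R]_n) (lam : n.-tuple R) (a b : R) :
    gen_eigenvalues B D lam ->
  \det (a *: D - b *: B) = \det D * \prod_(x <- lam) (a - b * x).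
Proof.
move=> [_ polyE]; have [->|b0] := eqVneq b 0.
  rewrite scale0r subr0 detZ mulrC; congr (_ * _).
  under eq_bigr do rewrite mul0r subr0.
  by rewrite prod_const_tuple.
have := congr1 (horner^~ (a / b)) polyE.
rewrite hornerM hornerC horner_prod /gen_char_poly -[LHS]/(horner_eval _ _).
rewrite -det_map_mx => detE.
have -> : a *: D - b *: B = - b *: (B - (a / b) *: D).
  by rewrite scalerBr scalerA !scaleNr mulNr scaleNr opprK mulrC divfK // addrC.
have mapE : map_mx (horner_eval (a / b))
    (map_mx polyC B - 'X *: map_mx polyC D) = B - (a / b) *: D.
  by apply/matrixP => i j; rewrite !mxE /= /horner_eval !hornerE.
rewrite detZ -mapE detE mulrCA; congr (_ * _).
rewrite -(prod_const_tuple lam) -big_split; apply: eq_bigr => x _ /=.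
by rewrite !hornerE; field.
Qed.

(** Right multiplication by [[d, 0], [- C, 1]] clears the lower left block. *)
Lemma det_block_scalar_dr n (A B C : 'M[R]_n) (d : R) : d != 0 ->
  \det (block_mx A B C d%:M) = \det (d *: A - B *m C).
Proof.
move=> d0; have dn0 : \det (d%:M : 'M[R]_n) != 0.
  by rewrite det_scalar expf_neq0.
apply: (mulIf dn0); rewrite -[X in _ = _ * X]mul1r.
have := congr1 determinant
  (mulmx_block A B C d%:M (d%:M : 'M_n) 0 (- C) (1%:M : 'M_n)).
rewrite det_mulmx det_lblock det1 mulr1 => ->.
rewrite !mulmx0 !mulmx1 !add0r !mulmxN !mul_mx_scalar !mul_scalar_mx subrr.
by rewrite det_ublock mul1r.
Qed.

(** The lower right block of x - M is the scalar e = x - (1 - a).  Away from its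
    zero the determinant equals det G^-1 det (u G - v B), because the product
    of the off-diagonal blocks is affine in G^-1 B. *)
Lemma char_poly_admm_block n (B G : 'M[R]_n) (lam : n.-tuple R) (a b : R) :
    G \in unitmx -> gen_eigenvalues B G lam ->
  char_poly (block_mx ((a * b) *: (invmx G *m B) + 1%:M) ((a * b) *: invmx G)
                      (- (a / 2) *: (B + G)) (1 - a)%:M)
  = \prod_(l <- lam) quad_poly (mode_trace a b l) (mode_det a b l).
Proof.
move=> uG lamE; apply: (@poly_eq_off_point _ _ (1 - a)) => x xa.
pose e := x - (1 - a); have e0 : e != 0 by rewrite subr_eq0.
rewrite /char_poly -[LHS]/(horner_eval x _) -det_map_mx.
set A := map_mx _ _.
have -> : A = block_mx ((x - 1)%:M - (a * b) *: (invmx G *m B))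
    (- (a * b) *: invmx G) ((a / 2) *: (B + G)) e%:M.
  transitivity (x%:M - block_mx ((a * b) *: (invmx G *m B) + 1%:M)
    ((a * b) *: invmx G) (- (a / 2) *: (B + G)) (1 - a)%:M).
    apply/matrixP => i j; rewrite !mxE /= /horner_eval !hornerE.
    by rewrite hornerMn hornerX.
  rewrite scalar_mx_block opp_block_mx add_block_mx !add0r !scaleNr opprK.
  by rewrite opprD addrCA addrC -!raddfB.
rewrite det_block_scalar_dr //.
(* u - v l is the value at x of the characteristic polynomial of mode l *)
pose u := (x - 1) * e + a ^+ 2 * b / 2.
pose v := a * b * e - a ^+ 2 * b / 2.
have -> : e *: ((x - 1)%:M - (a * b) *: (invmx G *m B)) -
    - (a * b) *: invmx G *m (a / 2 *: (B + G)) = invmx G *m (u *: G - v *: B).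
  rewrite -scalemxAl -!scalemxAr mulmxDr mulmxBr -!scalemxAr mulVmx //.
  move: (invmx G *m B) => T; apply/matrixP => i j; rewrite !mxE.
  rewrite -[(x - 1) *+ _]mulr_natr /u /v; move: (_%:R) (T i j) => dij Tij.
  by field.
rewrite det_mulmx (det_pencil _ _ lamE) mulrA -det_mulmx mulVmx // det1 mul1r.
rewrite horner_prod; apply: eq_bigr => l _.
rewrite /quad_poly 2!hornerD hornerN hornerZ hornerXn hornerX hornerC.
rewrite /u /v /e /mode_trace /mode_det.
by field.
Qed.

End Pencil.

(** * Order of vanishing of a symmetric pencil *)

Section Multiplicity.
Variable R : realType.

Lemma posdef_unit n (G : 'M[R]_n) : posdef G -> G \in unitmx.
Proof.
move=> [symG posG]; rewrite unitmxE unitfE; apply/det0P => -[v v0 vG].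
have := posG v^T; rewrite trmx_eq0 => /(_ v0).
by rewrite trmxK vG mul0mx mxE ltxx.
Qed.

Lemma posdef_congr n (G V : 'M[R]_n) :
  posdef G -> V \in unitmx -> posdef (V *m G *m V^T).
Proof.
move=> [symG posG] uV; split; first by rewrite !trmx_mul trmxK symG mulmxA.
move=> x x0; have := posG (V^T *m x); rewrite trmx_mul trmxK !mulmxA; apply.
have uVt : V^T \in unitmx by rewrite unitmx_tr.
by apply: contra_neq x0 => Vx0; rewrite -[x](mulKmx uVt) Vx0 mulmx0.
Qed.

(** Symmetry and S = D X, with D the projector onto the first r coordinates,
    confine S to its upper left r x r block.  The last n - r rows of y G + S are
    then y times those of G, and taking these factors out leaves a matrix
    polynomial A in y, invertible at y = 0. *)
Lemma det_pencil_order_pid n r (G S X : 'M[R]_n) : posdef G ->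
    (r <= n)%N -> S^T = S -> X \in unitmx -> S = pid_mx r *m X ->
  exists2 q : {poly R}, q.[0] != 0 &
    forall y, \det (y *: G + S) = y ^+ (n - r) * q.[y].
Proof.
move=> [symG posG] rn symS uX SE.
have SEt : S = X^T *m pid_mx r by rewrite -[LHS]symS SE trmx_mul tr_pid_mx.
have S0 (i j : 'I_n) : (r <= i)%N -> S i j = 0.
  move=> ri; rewrite SE !mxE big1 // => k _.
  by rewrite !mxE ltnNge ri andbF mul0r.
pose A : 'M[{poly R}]_n :=
  \matrix_(i, j) if (i < r)%N then G i j *: 'X + (S i j)%:P else (G i j)%:P.
pose H : 'M[R]_n := \matrix_(i, j) if (i < r)%N then S i j else G i j.
exists (\det A) => [|y].
  rewrite -[X in X != 0]/(horner_eval 0 _) -det_map_mx.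
  have -> : map_mx (horner_eval 0) A = H.
    apply/matrixP => i j; rewrite !mxE /horner_eval.
    by case: ifP => _; rewrite !hornerE // mulr0 add0r.
  (* a null vector v of H satisfies S v = 0, so its first r entries vanish, and
     G v vanishes on the other ones; hence v^T G v = 0 *)
  rewrite -det_tr; apply/det0P => -[v v0 vH].
  have Hi i : \sum_j H i j * v 0 j = 0.
    have := congr1 (fun M : 'rV[R]_n => M 0 i) vH.
    rewrite !mxE => vHi; rewrite -[RHS]vHi.
    by apply: eq_bigr => j _; rewrite [H^T _ _]mxE mulrC.
  have Sv : S *m v^T = 0.
    apply/colP => i; rewrite !mxE; have [ir|ri] := ltnP i r.
      rewrite -[RHS](Hi i); apply: eq_bigr => j _.
      by rewrite !mxE ir.
    by rewrite big1 // => j _; rewrite S0 // mul0r.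
  have Dv : pid_mx r *m v^T = 0 :> 'cV[R]_n.
    have uXt : X^T \in unitmx by rewrite unitmx_tr.
    by rewrite -[pid_mx r](mulKmx uXt) -SEt -mulmxA Sv mulmx0.
  have := posG v^T; rewrite trmx_eq0 => /(_ v0).
  rewrite trmxK -mulmxA mxE big1 ?ltxx // => i _.
  have [ir|ri] := ltnP i r.
    have := congr1 (fun M : 'cV[R]_n => M i 0) Dv.
    rewrite !mxE (bigD1 i) //= !mxE eqxx ir mul1r big1 ?addr0 => [->|j ji].
      by rewrite mul0r.
    by rewrite !mxE eq_sym (inj_eq val_inj) (negPf ji) mul0r.
  rewrite [X in _ * X](_ : _ = 0) ?mulr0 // mxE -[RHS](Hi i).
  by apply: eq_bigr => j _; rewrite !mxE ltnNge ri.
pose d : 'rV[R]_n := \row_i if (i < r)%N then 1 else y.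
have -> : y *: G + S = diag_mx d *m map_mx (horner_eval y) A.
  rewrite mul_diag_mx; apply/matrixP => i j; rewrite !mxE /horner_eval.
  case: ltnP => ri; rewrite !hornerE ?mul1r; first by rewrite mulrC.
  by rewrite S0 // addr0.
rewrite det_mulmx det_map_mx det_diag; congr (_ * _).
have -> : \prod_i d 0 i = \prod_(0 <= i < n) if (i < r)%N then 1 else y.
  by rewrite big_mkord; apply: eq_bigr => i _; rewrite mxE.
rewrite (@big_cat_nat _ _ _ r) //= big_nat big1 ?mul1r => [|i /andP[_ ->]] //.
rewrite -prodr_const_nat [LHS]big_nat [RHS]big_nat; apply: eq_bigr => i.
by case/andP => ri _; rewrite ltnNge ri.
Qed.

(** A congruence by the inverse of the column basis of S reduces to a pencil of
    the preceding form. *)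
Lemma det_pencil_order n (G S : 'M[R]_n) : posdef G -> S^T = S ->
  exists2 q : {poly R}, q.[0] != 0 &
    forall y, \det (y *: G + S) = y ^+ (n - \rank S) * q.[y].
Proof.
move=> posG symS; pose V := invmx (col_ebase S).
have uV : V \in unitmx by rewrite unitmx_inv col_ebase_unit.
have [|||q q0 qE] := @det_pencil_order_pid _ (\rank S) _ (V *m S *m V^T)
  (row_ebase S *m V^T) (posdef_congr posG uV) (rank_leq_row S).
- by rewrite !trmx_mul trmxK symS mulmxA.
- by rewrite unitmx_mul row_ebase_unit unitmx_tr.
- rewrite mulmxA; congr (_ *m _).
  by apply: (canLR (mulKmx (col_ebase_unit S))); rewrite mulmxA mulmx_ebase.
have V0 : \det V * \det V != 0 by rewrite mulf_neq0 // -unitfE -unitmxE.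
exists ((\det V * \det V)^-1 *: q).
  by rewrite hornerZ mulf_neq0 ?invr_eq0.
move=> y; rewrite hornerZ mulrCA -qE.
rewrite scalemxAl scalemxAr -mulmxDl -mulmxDr !det_mulmx det_tr.
by rewrite mulrAC mulrA mulVf // mul1r.
Qed.

Lemma poly_order_inj (p q : {poly R}) (i j : nat) :
  p.[0] != 0 -> q.[0] != 0 -> 'X^i * p = 'X^j * q -> i = j.
Proof.
wlog: p q i j / (i <= j)%N => [hw p0 q0 e|].
  have [ij|/ltnW ij] := leqP i j; first exact: (hw p q).
  by apply/esym/(hw q p).
move=> ij p0 q0; rewrite -(subnK ij) addnC exprD -mulrA.
move/(mulfI (expf_neq0 i (negbT (polyX_eq0 R)))) => pE.
move: p0; rewrite pE hornerM hornerXn expr0n; case: (j - i)%N => [|k].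
  by rewrite addn0.
by rewrite mul0r eqxx.
Qed.

(** The algebraic multiplicity of the root y = 0 is the dimension of the kernel
    of S, as for a diagonalizable matrix; comparing orders of vanishing avoids
    diagonalizing in the inner product of G. *)
Lemma count_pencil n (G S : 'M[R]_n) (lam : seq R) :
    posdef G -> S^T = S ->
    (forall y, \det (y *: G + S) = \det G * \prod_(x <- lam) (y + (1 - x))) ->
  count_mem 1 lam = (n - \rank S)%N.
Proof.
move=> posG symS detE; have [q q0 qE] := det_pencil_order posG symS.
have uG := posdef_unit posG.
pose p := (\det G)%:P * \prod_(x <- [seq x <- lam | x != 1]) ('X + (1 - x)%:P).
apply: (@poly_order_inj p q) => //.
  rewrite hornerM hornerC; apply: mulf_neq0; first by rewrite -unitfE -unitmxE.
  rewrite horner_prod prodf_seq_neq0; apply/allP => x.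
  by rewrite mem_filter !hornerE subr_eq0 eq_sym => /andP[].
apply: (@poly_eq_off_point _ _ _ 0) => y _.
rewrite [RHS]hornerM hornerXn -qE detE /p !hornerM hornerXn hornerC mulrCA.
congr (_ * _); rewrite [RHS](bigID (pred1 1)) horner_prod big_filter /=.
congr (_ * _); last by apply: eq_bigr => x _; rewrite !hornerE.
rewrite -big_filter; have /all_pred1P -> := filter_all (pred1 1) lam.
by rewrite big_nseq subrr addr0 size_filter -Monoid.iteropE.
Qed.

End Multiplicity.

(** * Generalized eigenvalues of the reflected Gram matrix *)

Section AdmmSpectrum.
Variable R : realType.

Lemma sqr_norm_ge0 k (u : 'cV[R]_k) : 0 <= (u^T *m u) 0 0.
Proof. by rewrite mxE sumr_ge0 // => i _; rewrite mxE -expr2 sqr_ge0. Qed.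

Lemma sqr_norm_eq0 k (u : 'cV[R]_k) : u^T *m u = 0 -> u = 0.
Proof.
move/(congr1 (fun M : 'M[R]_1 => M 0 0)); rewrite !mxE => /eqP.
rewrite psumr_eq0 => [/allP u0|i _]; last by rewrite mxE -expr2 sqr_ge0.
apply/colP => i; move: (u0 i (mem_index_enum i)).
by rewrite mxE -expr2 sqrf_eq0 => /eqP ->; rewrite mxE.
Qed.

Lemma gram_form k n (X : 'M[R]_(k, n)) (v : 'cV[R]_n) :
  v^T *m (X^T *m X) *m v = (X *m v)^T *m (X *m v).
Proof. by rewrite trmx_mul !mulmxA. Qed.

Lemma orth_proj_gram p n m (A : 'M[R]_(p, n)) (C : 'M[R]_(p, m)) :
  A^T *m orth_proj C *m A = (orth_proj C *m A)^T *m (orth_proj C *m A).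
Proof.
have [idP symP _] := orth_projP C.
by rewrite trmx_mul symP -!mulmxA; congr (_ *m _); rewrite !mulmxA idP.
Qed.

Lemma orth_proj_compl_gram p n m (A : 'M[R]_(p, n)) (C : 'M[R]_(p, m))
    (N := 1%:M - orth_proj C) :
  A^T *m N *m A = (N *m A)^T *m (N *m A).
Proof.
have [idP symP _] := orth_projP C.
have symN : N^T = N by rewrite linearB /= trmx1 symP.
have idN : N *m N = N by rewrite mulmxBr mulmx1 mulmxBl mul1mx idP subrr subr0.
by rewrite trmx_mul symN -!mulmxA; congr (_ *m _); rewrite !mulmxA idN.
Qed.

(** The kernel of this Gram matrix consists of the v with (1 - P) A v = 0, that
    is, with A v in the range of C; A maps it injectively onto the intersection
    of the two ranges. *)
Lemma rank_orth_compl_gram p n m (A : 'M[R]_(p, n)) (C : 'M[R]_(p, m)) :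
    row_free A^T ->
  \rank (A^T *m (1%:M - orth_proj C) *m A) = (n - dim_range_cap A C)%N.
Proof.
move=> freeA; set N := 1%:M - orth_proj C; set S := A^T *m N *m A.
have [idP symP rangeP] := orth_projP C.
have rkS : (\rank S <= n)%N by exact: rank_leq_row.
suff -> : dim_range_cap A C = (n - \rank S)%N by rewrite subKn.
rewrite -mxrank_ker -(mxrankMfree (kermx S) freeA) /dim_range_cap.
suff e : (A^T :&: C^T == kermx S *m A^T)%MS by rewrite (eqmxP e).
apply/andP; split.
  apply/rV_subP => u; rewrite sub_capmx => /andP[/submxP[w uE] uC].
  rewrite uE submxMr // sub_kermx /S !mulmxA -uE.
  rewrite -rangeP in uC; case/submxP: uC => z ->.
  by rewrite mulmxBr mulmx1 symP -mulmxA idP subrr mul0mx.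
rewrite sub_capmx submxMl /= -rangeP symP.
have -> : kermx S *m A^T = kermx S *m A^T *m orth_proj C.
  apply/eqP; rewrite -subr_eq0 -[X in X - _]mulmx1 -mulmxBr; apply/eqP.
  apply/row_matrixP => i; rewrite row0 -mulmxA row_mul; set u := row i _.
  have uS : u *m S = 0 by apply/sub_kermxP; exact: row_sub.
  have /sqr_norm_eq0 NAu : (N *m A *m u^T)^T *m (N *m A *m u^T) = 0.
    by rewrite -gram_form -orth_proj_compl_gram trmxK uS mul0mx.
  apply: trmx_inj; rewrite trmx0 -NAu !trmx_mul trmxK.
  by rewrite linearB /= trmx1 symP.
exact: submxMl.
Qed.

Lemma reflection_gram p n (A : 'M[R]_(p, n)) (P : 'M[R]_p) :
  A^T *m (2%:R *: P - 1%:M) *m A = 2%:R *: (A^T *m P *m A) - A^T *m A.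
Proof. by rewrite mulmxBr mulmx1 mulmxBl -scalemxAr -scalemxAl. Qed.

(** For an eigenvector v, (1 + l) v^T G v and (1 - l) v^T G v are twice the
    squared norms of P A v and of (1 - P) A v. *)
Lemma reflection_eigenvalue_itv p n m (A : 'M[R]_(p, n)) (C : 'M[R]_(p, m)) l :
    posdef (A^T *m A) ->
    gen_eigenvalue (A^T *m (2%:R *: orth_proj C - 1%:M) *m A) (A^T *m A) l ->
  -1 <= l <= 1.
Proof.
move=> [_ posG] [v v0 vE]; have g0 := posG v v0.
set P := orth_proj C in vE.
have pE : 2 * (v^T *m (A^T *m P *m A) *m v) 0 0
          = (1 + l) * (v^T *m (A^T *m A) *m v) 0 0.
  apply/eqP; rewrite -subr_eq0; apply/eqP.
  have := congr1 (fun u => (v^T *m u) 0 0) vE; rewrite /= mulmx0 [RHS]mxE => <-.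
  rewrite reflection_gram -addrA -opprD -{2}[A^T *m A]scale1r -scalerDl.
  rewrite mulmxBl mulmxBr -!scalemxAl -!scalemxAr.
  by rewrite !mulmxA !mxE.
have nE : 2 * (v^T *m (A^T *m (1%:M - P) *m A) *m v) 0 0
          = (1 - l) * (v^T *m (A^T *m A) *m v) 0 0.
  rewrite mulmxBr mulmx1 mulmxBl mulmxBr mulmxBl mxE [X in _ + X]mxE.
  by rewrite mulrBr pE; ring.
have := sqr_norm_ge0 (P *m A *m v).
rewrite -gram_form -orth_proj_gram => p0.
have := sqr_norm_ge0 ((1%:M - P) *m A *m v).
rewrite -gram_form -orth_proj_compl_gram => n0.
by apply/andP; split; nra.
Qed.

Lemma reflection_eigenvalues_split n m p (A : 'M[R]_(p, n))
    (C : 'M[R]_(p, m)) (lam : n.-tuple R) (s := dim_range_cap A C) :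
    posdef (A^T *m A) ->
    gen_eigenvalues (A^T *m (2%:R *: orth_proj C - 1%:M) *m A) (A^T *m A) lam ->
  exists2 mu : seq R,
    tval lam = mu ++ nseq s 1 & {in mu, forall l, -1 <= l < 1}.
Proof.
move=> pdG lamE; have uG := posdef_unit pdG.
have lam_itv l : l \in lam -> -1 <= l <= 1.
  move=> llam; apply: (reflection_eigenvalue_itv (C := C) pdG).
  by apply/(mem_gen_eigenvalues _ uG lamE).
have lam_le1 : all (<= 1) lam by apply/allP => l /lam_itv /andP[].
pose S := A^T *m (1%:M - orth_proj C) *m A.
have symS : (2%:R *: S)^T = 2%:R *: S.
  by rewrite linearZ /= /S orth_proj_compl_gram trmx_mul trmxK.
have freeA : row_free A^T.
  rewrite /row_free eqn_leq rank_leq_row /=.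
  by have := mxrankM_maxl A^T A; rewrite (mxrank_unit uG).
have countE : count_mem 1 lam = s.
  rewrite (count_pencil pdG symS) => [|y].
    rewrite eqmx_scale ?pnatr_eq0 // rank_orth_compl_gram // subKn //.
    by rewrite (leq_trans (mxrankS (capmxSl _ _))) ?rank_leq_row.
  (* G - B = 2 S, so that y G + 2 S = (y + 1) G - B *)
  have -> : y *: (A^T *m A) + 2%:R *: S = (y + 1) *: (A^T *m A) -
      1 *: (A^T *m (2%:R *: orth_proj C - 1%:M) *m A).
    rewrite reflection_gram /S mulmxBr mulmx1 mulmxBl; move: (A^T *m A) => G.
    move: (_ *m A) => H; apply/matrixP => i j; rewrite !mxE; ring.
  rewrite (det_pencil _ _ lamE); congr (_ * _); apply: eq_bigr => l _; ring.
have [sorted_lam _] := lamE; exists [seq y <- lam | y != 1].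
  by rewrite -countE; exact: sorted_split_max.
by move=> l; rewrite mem_filter lt_neqAle => /andP[-> /lam_itv].
Qed.

End AdmmSpectrum.

(** * The convergence factor *)

Section AdmmFactor.
Variable R : realType.

(** With G = kappa Q, the matrix Q + rho G is G / (kappa (1 - b)), which turns
    a rho (Q + rho G)^-1 into a b G^-1. *)
Lemma admm_matrix_normal n m p (Q : 'M[R]_n) (A : 'M[R]_(p, n))
    (C : 'M[R]_(p, m)) (kappa a b : R)
    (G := A^T *m A) (B := A^T *m (2%:R *: orth_proj C - 1%:M) *m A) :
    0 < kappa -> 0 < b < 1 -> posdef Q -> G = kappa *: Q ->
  admm_matrix Q A C a (step_of_beta kappa b)
  = block_mx ((a * b) *: (invmx G *m B) + 1%:M) ((a * b) *: invmx G)
             (- (a / 2) *: (B + G)) (1 - a)%:M.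
Proof.
move=> k0 /andP[b0 b1] pdQ GE; have uQ := posdef_unit pdQ.
have kn0 : kappa != 0 by rewrite gt_eqF.
have b1' : 1 - b != 0 by rewrite subr_eq0 gt_eqF.
have uG : G \in unitmx by rewrite GE unitmxZ ?unitfE.
set rho := step_of_beta kappa b.
have KE : invmx (Q + rho *: G) = (kappa * (1 - b)) *: invmx G.
  have -> : Q + rho *: G = (kappa * (1 - b))^-1 *: G.
    rewrite GE scalerA -{1}[Q]scale1r -scalerDl scalerA; congr (_ *: _).
    by rewrite /rho /step_of_beta; field; rewrite b1'.
  rewrite invmxZ ?invrK // unitmxZ // unitfE invr_eq0.
  by rewrite mulf_neq0.
have rhoE : a * rho * (kappa * (1 - b)) = a * b.
  by rewrite /rho /step_of_beta; field; rewrite b1'.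
rewrite /admm_matrix KE -/rho; congr block_mx.
- by rewrite -!scalemxAl scalerA rhoE /B !mulmxA.
- by rewrite scalerA rhoE.
- rewrite /B reflection_gram subrK scalerA; congr (_ *: _).
  by field.
Qed.

(** For l = 1 the mode is (X - 1) (X - (1 - a (1 - b))). *)
Lemma prod_mode_quad_nseq a b k :
  \prod_(l <- nseq k 1) quad_poly (mode_trace a b l) (mode_det a b l)
  = ('X - (1 - a * (1 - b))%:P) ^+ k * ('X - 1) ^+ k :> {poly R}.
Proof.
rewrite big_nseq -Monoid.iteropE -exprMn; congr (_ ^+ _).
rewrite -polyC1 -quad_factor /quad_poly.
by congr (_ - _ *: _ + _%:P); rewrite /mode_trace /mode_det; field.
Qed.

Lemma admm_factor_le n m p (Q : 'M[R]_n) (A : 'M[R]_(p, n))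
    (C : 'M[R]_(p, m)) (kappa : R) (lam : n.-tuple R) (mu : seq R)
    (s := dim_range_cap A C) :
    0 < kappa -> posdef Q -> A^T *m A = kappa *: Q -> (0 < s)%N ->
    gen_eigenvalues (A^T *m (2%:R *: orth_proj C - 1%:M) *m A) (A^T *m A) lam ->
    tval lam = mu ++ nseq s 1 -> {in mu, forall l, -1 <= l < 1} ->
  forall a b t, 0 < a <= 2 -> 0 < b < 1 ->
  admm_factor Q A C a (step_of_beta kappa b) <= t <->
  `|1 - a * (1 - b)| <= t /\ {in mu, forall l, mode_in_disc a b l t}.
Proof.
move=> k0 pdQ GE s0 lamE lam_split mu_itv a b t a02 b01.
have uG : A^T *m A \in unitmx.
  by rewrite GE unitmxZ ?posdef_unit // unitfE gt_eqF.
have size_mu : (2 * n - s = 2 * size mu + s)%N.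
  have := congr1 size lam_split; rewrite size_tuple size_cat size_nseq => ->.
  by rewrite mulnDr -addnBA ?leq_pmull // [(2 * s)%N]mul2n -addnn addnK.
rewrite /admm_factor -/s size_mu; apply: entry_magnitudes_le => //.
- rewrite admm_matrix_normal // (char_poly_admm_block _ _ uG lamE) lam_split.
  by rewrite big_cat /= prod_mode_quad_nseq mulrA.
- have [/andP[a0 a2] /andP[b0 b1]] := (a02, b01).
  by rewrite ler_norml; apply/andP; split; nra.
- move=> l /mu_itv /andP[l0 l1]; apply: mode_in_unit_disc => //.
  by rewrite l0 ltW.
Qed.

Lemma dim_range_cap_gt0 n m p (A : 'M[R]_(p, n))
    (C : 'M[R]_(p, m)) (x : 'cV[R]_n) (z : 'cV[R]_m) :
  A *m x + C *m z = 0 -> A *m x != 0 -> (0 < dim_range_cap A C)%N.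
Proof.
move=> Axz Ax0; rewrite /dim_range_cap lt0n mxrank_eq0.
apply: contraNneq Ax0 => cap0; rewrite -trmx_eq0 -submx0 -cap0 sub_capmx.
rewrite trmx_mul submxMl /= -trmx_mul.
have -> : A *m x = - (C *m z) by apply/eqP; rewrite -addr_eq0 Axz.
by rewrite linearN /= eqmx_opp trmx_mul submxMl.
Qed.

End AdmmFactor.

(** * Optimization of a single mode *)

Section ModeOptimum.
Variable R : realFieldType.
Implicit Types a b l t : R.

(** The equation on b0 says that the mode l has a zero discriminant.  Its only
    root in (0, 1) separates the b with real roots (b <= b0) from those with
    complex ones. *)
Lemma double_root_unique l b0 a0 a b (w := (1 - b0 * l) / 2) :
    0 < l < 1 -> 0 < b0 < 1 -> b0 ^+ 2 * l ^+ 2 - 2 * b0 + 1 = 0 ->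
    0 < a <= a0 -> a0 <= 2 -> 0 < b < 1 ->
  mode_in_disc a b l (1 - a0 * w) -> a = a0 /\ b = b0.
Proof.
move=> /andP[l0 l1] /andP[b00 b01] eqb0 /andP[a_gt0 le_a] a02 /andP[b_gt0 b1].
have wE : b0 * l = 1 - 2 * w by rewrite /w; field.
have bl1 : b0 * l < 1 by nra.
have w0 : 0 < w by rewrite /w; lra.
have bl0 : 0 < b0 * l by rewrite mulr_gt0.
have aw1 : a0 * w < 1 by nra.
have w2E : w ^+ 2 = w * (1 - b0 * l) - b0 * (1 - l) / 2.
  by have := eqb0; rewrite -exprMn wE; lra.
rewrite /mode_in_disc /mode_trace /mode_det => -[].
rewrite ler_norml => /andP[_ htau] hdelta hp _.
have h_aw : a * w <= a0 * w by rewrite ler_pM2r.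
have c0 : 0 < a * l + a ^+ 2 * (1 - l) / 2.
  by rewrite addr_gt0 ?mulr_gt0 ?invr_gt0 ?exprn_gt0 ?subr_gt0.
have detE : (1 - a * w) ^+ 2
    = 1 - a + a * b0 * l + a ^+ 2 * b0 * (1 - l) / 2.
  have -> : (1 - a * w) ^+ 2 = 1 - 2 * a * w + a ^+ 2 * w ^+ 2 by ring.
  by rewrite w2E /w; nra.
have le_sq : (1 - a0 * w) ^+ 2 <= (1 - a * w) ^+ 2.
  by rewrite ler_sqr ?nnegrE; lra.
(* at b = b0 the mode has the double root 1 - a w, and the determinant
   increases with b *)
have le_b : b <= b0.
  rewrite leNgt; apply/negP => b0b.
  have : 0 < (b - b0) * (a * l + a ^+ 2 * (1 - l) / 2).
    by rewrite mulr_gt0 ?subr_gt0.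
  by lra.
(* as a quadratic in u / a, with u = a0 w, the value of the mode at 1 - u is
   decreasing from w to the vertex, and at w it has the sign of b - b0 *)
have eq_b : b = b0.
  apply/eqP; rewrite eq_le le_b leNgt /=; apply/negP => bb0.
  have h1 : (a0 * w - a * w) * (a0 * w + a * w - a * (1 - b * l)) <= 0.
    by rewrite mulr_ge0_le0; lra.
  have h2 : a ^+ 2 * (b - b0) * (w * l + (1 - l) / 2) < 0.
    rewrite -mulrA pmulr_rlt0 ?exprn_gt0 // nmulr_rlt0 ?subr_lt0 //.
    by rewrite addr_gt0 ?mulr_gt0 ?invr_gt0 ?subr_gt0.
  have : a ^+ 2 * w ^+ 2 = a ^+ 2 * (w * (1 - b0 * l) - b0 * (1 - l) / 2).
    by rewrite w2E.
  by nra.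
split=> //; apply/eqP; rewrite eq_le le_a /=.
subst b; have : (1 - a * w) ^+ 2 <= (1 - a0 * w) ^+ 2 by rewrite detE.
by rewrite ler_sqr ?nnegrE; [rewrite lerD2l lerN2 ler_pM2r | lra | lra].
Qed.

(** Each disc condition for l' is affine in l', and therefore holds between l1
    and l as soon as it holds at the relevant end: equality at l for the
    determinant and for the evaluation at the double root, and the two last
    hypotheses at l1 for the lower bound on the trace and for the evaluation at
    the opposite of the double root. *)
Lemma double_root_attained l b0 a l1 l' (w := (1 - b0 * l) / 2) :
    0 < l < 1 -> 0 < b0 < 1 -> b0 ^+ 2 * l ^+ 2 - 2 * b0 + 1 = 0 ->
    0 < a <= 2 -> l1 <= l' <= l -> a * (2 - b0 * (l + l1)) <= 4 ->
    0 <= (2 - a * w) ^+ 2 - a * (2 - a * w) * (1 - b0 * l1)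
         + a ^+ 2 * b0 * (1 - l1) / 2 ->
  mode_in_disc a b0 l' (1 - a * w).
Proof.
move=> /andP[l0 l_1] /andP[b00 b01] eqb0 /andP[a_gt0 a2] /andP[l1l' l'l].
move=> h1 h2.
have wE : b0 * l = 1 - 2 * w by rewrite /w; field.
have ab0 : 0 < a * b0 by rewrite mulr_gt0.
have bl0 : 0 < b0 * l by rewrite mulr_gt0.
have bl1 : b0 * l < 1 by nra.
have aw1 : a * w < 1 by nra.
(* the products of b0 l and b0 by powers of a and w that occur below, rewritten
   in a form free of l so that the inequalities are linear in monomials *)
have b0E : b0 = 2 * w ^+ 2 - 2 * w + 1.
  by move: eqb0; rewrite -exprMn wE; lra.
have e1 : a ^+ 2 * (b0 * l) = a ^+ 2 * (1 - 2 * w) by rewrite wE.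
have e2 : a ^+ 2 * b0 = a ^+ 2 * (2 * w ^+ 2 - 2 * w + 1) by rewrite -b0E.
have e3 : a ^+ 2 * w * (b0 * l) = a ^+ 2 * w * (1 - 2 * w) by rewrite wE.
have ab_l1 : a * b0 * l1 <= a * b0 * l' by rewrite ler_pM2l.
have ab_l : a * b0 * l' <= a * b0 * l by rewrite ler_pM2l.
have awE : a * b0 * l = a - 2 * (a * w) by rewrite -mulrA wE; ring.
rewrite /mode_in_disc /mode_trace /mode_det; split.
- rewrite ler_norml; apply/andP; split; lra.
- have : 0 <= a * b0 * ((1 - a / 2) * (l - l')).
    by rewrite (mulr_ge0 (ltW ab0)) // mulr_ge0 //; lra.
  by lra.
- have : 0 <= a * b0 * (a * (b0 * l) * (l - l')).
    by rewrite (mulr_ge0 (ltW ab0)) // !mulr_ge0 ?subr_ge0 // ltW.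
  by rewrite wE; lra.
- have : 0 <= a * b0 * ((2 - a * w - a / 2) * (l' - l1)).
    by rewrite (mulr_ge0 (ltW ab0)) // mulr_ge0 //; lra.
  by lra.
Qed.

(** Here a0 (1 - 1/2) = a0 / 2 = 1 - t.  The evaluation of the mode at t forces
    b >= 1/2 for every l <= 1, while the root 1 - a (1 - b) forces b <= 1/2. *)
Lemma half_unique l l1 a b (a0 := 4 / (2 - l1)) (t := - l1 / (2 - l1)) :
    l1 <= 0 -> l <= 1 -> 0 < a <= a0 -> 0 < b < 1 ->
    `|1 - a * (1 - b)| <= t -> mode_in_disc a b l t -> a = a0 /\ b = 2^-1.
Proof.
move=> l1_0 l_1 /andP[a_gt0 le_a] /andP[b_gt0 b1].
have tE : t = 1 - a0 / 2 by rewrite /t /a0; field; lra.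
rewrite tE ler_norml => /andP[_ h1].
rewrite /mode_in_disc /mode_trace /mode_det => -[].
rewrite ler_norml => /andP[_ htau] _ hp _.
have ge_b : 2^-1 <= b.
  rewrite leNgt; apply/negP => bb.
  have k1 : (a0 - a) * (a0 / 2 + a / 2 - a * (1 - b * l)) <= 0.
    by rewrite mulr_ge0_le0; lra.
  have k2 : a ^+ 2 * (2 * b - 1) < 0 by rewrite pmulr_rlt0 ?exprn_gt0; lra.
  nra.
have le_b : b <= 2^-1 by nra.
have eb : b = 2^-1 by apply/eqP; rewrite eq_le le_b.
split=> //; apply/eqP; rewrite eq_le le_a /=; move: h1; rewrite eb; lra.
Qed.

(** At b = 1/2 the roots of the mode l' are 1 - a / 2 and 1 - a (1 - l') / 2;
    this value of a makes the two roots opposite for l1. *)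
Lemma half_attained l1 l' (a := 4 / (2 - l1)) (t := - l1 / (2 - l1)) :
  l1 <= l' <= 0 -> mode_in_disc a 2^-1 l' t.
Proof.
move=> /andP[l1l' l'0].
have d0 : 0 < 2 - l1 by lra.
have tE : t = 1 - a / 2 by rewrite /t /a; field; lra.
have a_gt0 : 0 < a by rewrite divr_gt0.
have a_l1 : a * l1 = 2 * a - 4 by rewrite /a; field; lra.
have k1 : a * l1 <= a * l' by rewrite ler_pM2l.
have k2 : a * l' <= 0 by rewrite pmulr_rle0.
rewrite tE /mode_in_disc /mode_trace /mode_det; split.
- by rewrite ler_norml; apply/andP; split; lra.
- have : 0 <= (a * l' - a * l1) * (2 - a) + (- (a * l1)) * (2 - a) by nra.
  nra.
- nra.
- have : 0 <= (2 - a) * (a * l' - a * l1) by nra.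
  nra.
Qed.

End ModeOptimum.

(** * The optimal parameters *)

Section Optimum.
Variable R : realType.

Lemma optimal_paramsI (f : R -> R -> R) (a0 b0 v : R) :
    0 < a0 <= 2 -> 0 < b0 < 1 -> f a0 b0 = v ->
    (forall a b, 0 < a <= a0 -> 0 < b < 1 -> f a b <= v -> a = a0 /\ b = b0) ->
  optimal_params f a0 b0 v.
Proof.
move=> /andP[a0_gt0 a02] b01 f0 uniq0; split=> // a b; split=> [[]|[-> ->]].
  move=> [/andP[a_gt0 _] le_a b_itv] /(_ a0 b0) fle; apply: uniq0 => //.
    by rewrite a_gt0.
  by rewrite -f0; apply: fle; split; rewrite ?a0_gt0.
have D0 : param_domain a0 a0 b0 by split; rewrite ?a0_gt0.
split=> // a' b' [/andP[a'_gt0 _] le_a' b'_itv].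
rewrite leNgt; apply/negP => lt_f.
have a'_itv : 0 < a' <= a0 by rewrite a'_gt0.
have f_le_v : f a' b' <= v by rewrite -f0 ltW.
by move: lt_f; have [-> ->] := uniq0 _ _ a'_itv b'_itv f_le_v; rewrite ltxx.
Qed.

Variables (f : R -> R -> R) (mu : seq R).
Hypothesis f_le : forall a b t : R, 0 < a <= 2 -> 0 < b < 1 ->
  f a b <= t <->
  `|1 - a * (1 - b)| <= t /\ {in mu, forall l, mode_in_disc a b l t}.

(** The value is the double root of the mode l: half the trace bounds the factor
    from below, and all the other modes stay within that radius. *)
Lemma optimal_double_root l l1 a0 b0 : l \in mu ->
    {in mu, forall x, l1 <= x <= l} -> 0 < l < 1 -> 0 < b0 < 1 ->
    b0 ^+ 2 * l ^+ 2 - 2 * b0 + 1 = 0 -> 0 < a0 <= 2 ->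
    a0 * (2 - b0 * (l + l1)) <= 4 ->
    0 <= (2 - a0 * ((1 - b0 * l) / 2)) ^+ 2
         - a0 * (2 - a0 * ((1 - b0 * l) / 2)) * (1 - b0 * l1)
         + a0 ^+ 2 * b0 * (1 - l1) / 2 ->
  optimal_params f a0 b0 (1 - a0 * ((1 - b0 * l) / 2)).
Proof.
move=> lmu mu_itv l01 b01 eqb0 a02 h1 h2.
have [/andP[l_gt0 l_lt1] /andP[b_gt0 b_lt1]] := (l01, b01).
have /andP[a_gt0 a_le2] := a02.
apply: optimal_paramsI => // [|a b /andP[a_gt0' le_a] b_itv].
  apply/eqP; rewrite eq_le; apply/andP; split.
    apply/f_le => //; split=> [|x /mu_itv xitv]; last first.
      exact: (double_root_attained l01 b01 eqb0 a02 xitv h1 h2).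
    have bl0 : 0 < b0 * l by rewrite mulr_gt0.
    have bl1 : b0 * l < 1 by nra.
    have sq0 : 0 <= (b0 * l) ^+ 2 by exact: sqr_ge0.
    have k1 : 0 <= a0 * (1 - b0 - (1 - b0 * l) / 2).
      rewrite mulr_ge0 ?(ltW a_gt0) //.
      have : 0 <= (b0 * l) * (1 - b0 * l) by rewrite mulr_ge0; lra.
      by lra.
    have k2 : a0 * (1 - b0 + (1 - b0 * l) / 2) <= a0 * 1.
      by rewrite ler_pM2l //; move: eqb0 sq0; rewrite exprMn; lra.
    by rewrite ler_norml; apply/andP; split; lra.
  have /f_le[//|//|_ /(_ l lmu)[htau _ _ _]] := lexx (f a0 b0).
  have := le_trans (ler_norm _) htau; rewrite /mode_trace; lra.
move/f_le => [||_ /(_ l lmu)] //; first by rewrite a_gt0' (le_trans le_a).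
by apply: double_root_unique => //; rewrite a_gt0'.
Qed.

Lemma optimal_half_beta l l1 : l \in mu -> l1 \in mu ->
    {in mu, forall x, l1 <= x <= l} -> l <= 0 ->
  optimal_params f (4 / (2 - l1)) 2^-1 (- l1 / (2 - l1)).
Proof.
move=> lmu l1mu mu_itv l0; set a0 := 4 / _; set t := - l1 / _.
have l1_0 : l1 <= 0 by have /andP[_ /le_trans->] := mu_itv _ l1mu.
have d0 : 0 < 2 - l1 by lra.
have a_gt0 : 0 < a0 by rewrite divr_gt0.
have a_le2 : a0 <= 2 by rewrite ler_pdivrMr //; lra.
have tE : t = 1 - a0 * (1 - 2^-1) by rewrite /t /a0; field; lra.
have b01 : 0 < (2^-1 : R) < 1 by apply/andP; split; lra.
have a02 : 0 < a0 <= 2 by rewrite a_gt0.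
have t0 : 0 <= t by rewrite divr_ge0 ?oppr_ge0 // ltW.
apply: optimal_paramsI => // [|a b /andP[a_gt0' le_a] b_itv].
  apply/eqP; rewrite eq_le; apply/andP; split.
    apply/f_le => //; split=> [|x /mu_itv/andP[l1x xl]].
      by rewrite -tE ger0_norm.
    by apply: half_attained; rewrite l1x (le_trans xl).
  have /f_le[//|//|h _] := lexx (f a0 2^-1).
  by apply: le_trans h; rewrite -tE ler_norm.
move/f_le => [||h /(_ l lmu)] //; first by rewrite a_gt0' (le_trans le_a).
by apply: half_unique => //; [exact: le_trans l0 _ | rewrite a_gt0'].
Qed.

Lemma double_root_beta (l : R) (b := (1 - Num.sqrt (1 - l ^+ 2)) / l ^+ 2) :
    0 < l < 1 ->
  0 < b < 1 /\ b ^+ 2 * l ^+ 2 - 2 * b + 1 = 0.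
Proof.
move=> /andP[l0 l1]; rewrite /b; set r := Num.sqrt _.
have l2 : 0 < l ^+ 2 by rewrite exprn_gt0.
have l21 : l ^+ 2 < 1 by rewrite expr_lt1 // ltW.
have r0 : 0 < r by rewrite sqrtr_gt0 subr_gt0.
have rE : r ^+ 2 = 1 - l ^+ 2 by rewrite sqr_sqrtr // subr_ge0 ltW.
have r1 : r < 1.
  by rewrite -(@ltr_sqr _ r 1) ?nnegrE ?(ltW r0) // rE expr1n; lra.
split.
  rewrite divr_gt0 ?subr_gt0 //= ltr_pdivrMr // mul1r; nra.
have -> : ((1 - r) / l ^+ 2) ^+ 2 * l ^+ 2 - 2 * ((1 - r) / l ^+ 2) + 1
    = (r ^+ 2 - (1 - l ^+ 2)) / l ^+ 2 by field; lra.
by rewrite rE subrr mul0r.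
Qed.

(** With a = 2 the conditions at l1 reduce to l + l1 >= 0. *)
Lemma optimal_full_relaxation (l l1 : R)
    (b := (1 - Num.sqrt (1 - l ^+ 2)) / l ^+ 2) :
    l \in mu -> {in mu, forall x, l1 <= x <= l} -> 0 < l < 1 -> `|l1| <= l ->
  optimal_params f 2 b ((1 - Num.sqrt (1 - l ^+ 2)) / l).
Proof.
move=> lmu mu_itv l01 l1_le; have /andP[l0 l_lt1] := l01.
have [b01 eqb] := double_root_beta l01; rewrite -/b in b01 eqb.
have /andP[b0 b1] := b01.
move: l1_le; rewrite ler_norml => /andP[h _].
have -> : (1 - Num.sqrt (1 - l ^+ 2)) / l = 1 - 2 * ((1 - b * l) / 2).
  by rewrite /b; field; lra.
have bl0 : 0 <= b * (l + l1) by rewrite mulr_ge0; lra.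
apply: (optimal_double_root lmu mu_itv l01 b01 eqb); rewrite ?lexx ?andbT //.
  by lra.
have bl_ge0 : 0 <= b * l by rewrite mulr_ge0 // ltW.
have := mulr_ge0 bl_ge0 bl0; lra.
Qed.

(** This value of a makes the smaller root of the mode l1 equal to the opposite
    of the double root, so that the evaluation at that point vanishes. *)
Lemma optimal_reduced_relaxation (l l1 : R)
    (b := (1 - Num.sqrt (1 - l ^+ 2)) / l ^+ 2)
    (a := 4 / (2 - (l + l1 - Num.sqrt (l1 ^+ 2 - l ^+ 2)) * b)) :
    l \in mu -> l1 \in mu -> {in mu, forall x, l1 <= x <= l} -> 0 < l < 1 ->
    l < `|l1| ->
  optimal_params f a b (1 + a / 2 * l * b - a / 2).
Proof.
move=> lmu l1mu mu_itv l01 l1_gt; have /andP[l0 l_lt1] := l01.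
have [b01 eqb] := double_root_beta l01; rewrite -/b in b01 eqb.
have /andP[b0 b1] := b01.
have l1N : l1 < - l.
  move: l1_gt; rewrite ltr_normr => /orP[|]; last by lra.
  by have /andP[_ ?] := mu_itv _ l1mu; lra.
have hE : Num.sqrt (l1 ^+ 2 - l ^+ 2) ^+ 2 = l1 ^+ 2 - l ^+ 2.
  by rewrite sqr_sqrtr // -[l1 ^+ 2]sqrrN subr_ge0 ler_sqr ?nnegrE; lra.
move: hE (sqrtr_ge0 (l1 ^+ 2 - l ^+ 2)); rewrite /a; set h := Num.sqrt _.
move=> hE h0; pose d := 2 - (l + l1 - h) * b; rewrite -/d.
have hb0 : 0 <= h * b by rewrite mulr_ge0 // ltW.
have lb : (l + l1) * b < 0 by rewrite pmulr_llt0 //; lra.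
have d2 : 2 <= d by rewrite /d; lra.
have d0 : 0 < d by lra.
have a0 : 0 < 4 / d by rewrite divr_gt0.
have ad : 4 / d * d = 4 by rewrite divfK ?gt_eqF.
have -> : 1 + 4 / d / 2 * l * b - 4 / d / 2 = 1 - 4 / d * ((1 - b * l) / 2).
  by field; lra.
apply: (optimal_double_root lmu mu_itv l01 b01 eqb).
- by rewrite a0 ler_pdivrMr //; lra.
- by rewrite -[leRHS]ad ler_pM2l // /d; lra.
(* in the variable w the mode of l1 has the roots (1 - b l1 -+ b h) / 2 *)
pose w := (1 - b * l1 + b * h) / 2.
have -> : 2 - 4 / d * ((1 - b * l) / 2) = 4 / d * w.
  transitivity (4 / d * d / 2 - 4 / d * ((1 - b * l) / 2)).
    by rewrite ad; lra.
  by rewrite /w /d; field; lra.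
have -> : (4 / d * w) ^+ 2 - 4 / d * (4 / d * w) * (1 - b * l1) +
    (4 / d) ^+ 2 * b * (1 - l1) / 2
  = (4 / d) ^+ 2 * (b ^+ 2 * h ^+ 2 - (1 - b * l1) ^+ 2 + 2 * b * (1 - l1)) / 4.
  by rewrite /w; field; lra.
have -> : b ^+ 2 * h ^+ 2 - (1 - b * l1) ^+ 2 + 2 * b * (1 - l1)
    = - (b ^+ 2 * l ^+ 2 - 2 * b + 1) by rewrite hE; ring.
by rewrite eqb oppr0 mulr0 mul0r.
Qed.

End Optimum.

Theorem theorem4 (R : realType) (n m p r : nat)
    (Q : 'M[R]_n) (E : 'M[R]_(p, n)) (F : 'M[R]_(p, m)) (W : 'M[R]_(r, p))
    (kappa : R) (lambda : n.-tuple R) :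
  let Eb := W *m E in
  let Fb := W *m F in
  let s := dim_range_cap Eb Fb in
  let lambda1 := entry lambda 1 in
  let lambdans := entry lambda (n - s) in
  let phi := fun alpha beta : R =>
    admm_factor Q Eb Fb alpha (step_of_beta kappa beta) in
  posdef Q ->
  row_full E ->
  row_full F ->
  (forall (x : 'cV[R]_n) (z : 'cV[R]_m),
     W *m (E *m x + F *m z) = 0 -> E *m x + F *m z = 0) ->
  (exists (x : 'cV[R]_n) (z : 'cV[R]_m),
     (x, z) != (0, 0) /\ Eb *m x + Fb *m z = 0) ->
  (s < n)%N ->
  0 < kappa ->
  Eb^T *m Eb = kappa *: Q ->
  gen_eigenvalues (Eb^T *m (2%:R *: orth_proj Fb - 1%:M) *m Eb)
    (Eb^T *m Eb) lambda ->
  [/\ (* Case I *)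
      0 < lambdans -> `|lambda1| <= lambdans ->
      let beta := (1 - Num.sqrt (1 - lambdans ^+ 2)) / lambdans ^+ 2 in
      optimal_params phi 2%:R beta
        ((1 - Num.sqrt (1 - lambdans ^+ 2)) / lambdans),
      (* Case II *)
      0 < lambdans -> lambdans < `|lambda1| ->
      let beta := (1 - Num.sqrt (1 - lambdans ^+ 2)) / lambdans ^+ 2 in
      let alpha := 4%:R / (2%:R - (lambdans + lambda1
                     - Num.sqrt (lambda1 ^+ 2 - lambdans ^+ 2)) * beta) in
      optimal_params phi alpha beta
        (1 + alpha / 2%:R * lambdans * beta - alpha / 2%:R)
    & (* Case III *)
      lambdans <= 0 -> lambda1 <= lambdans ->
      optimal_params phi (4%:R / (2%:R - lambda1)) (2%:R^-1)
        (- lambda1 / (2%:R - lambda1))].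
Proof.
move=> Eb Fb s lambda1 lambdans phi pdQ fullE fullF W_inj [x [z [xz0 feas]]].
move=> sn k0 GE lamE.
have inj_full q k (M : 'M[R]_(q, k)) (u : 'cV[R]_k) :
    row_full M -> M *m u = 0 -> u = 0.
  by move/row_fullP => [V VM] Mu; rewrite -[u]mul1mx -VM -mulmxA Mu mulmx0.
have Eb_inj (u : 'cV[R]_n) : Eb *m u = 0 -> u = 0.
  move=> Ebu; apply: (inj_full _ _ _ _ fullE).
  have := W_inj u 0; rewrite mulmx0 addr0; apply.
  by rewrite mulmxA.
have Fb_inj (u : 'cV[R]_m) : Fb *m u = 0 -> u = 0.
  move=> Fbu; apply: (inj_full _ _ _ _ fullF).
  have := W_inj 0 u; rewrite mulmx0 add0r; apply.
  by rewrite mulmxA.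
have s0 : (0 < s)%N.
  apply: (dim_range_cap_gt0 feas); apply: contra_neq xz0 => Ebx.
  by move: feas; rewrite Ebx add0r => /Fb_inj ->; rewrite (Eb_inj _ Ebx).
have pdG : posdef (Eb^T *m Eb).
  rewrite GE; have [symQ posQ] := pdQ; split; first by rewrite linearZ /= symQ.
  by move=> u u0; rewrite -scalemxAr -scalemxAl mxE mulr_gt0 ?posQ.
have [mu lam_split mu_itv] := reflection_eigenvalues_split pdG lamE.
have phi_le := admm_factor_le k0 pdQ GE s0 lamE lam_split mu_itv.
have size_mu : size mu = (n - s)%N.
  by rewrite -(size_tuple lambda) lam_split size_cat size_nseq addnK.
have mu_sorted : sorted <=%R mu.
  by have [+ _] := lamE; rewrite lam_split => /cat_sorted2[].
have mu_gt0 : (0 < size mu)%N by rewrite size_mu subn_gt0.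
have lambda1E : lambda1 = mu`_0.
  by rewrite /lambda1 /entry lam_split nth_cat mu_gt0.
have lambdansE : lambdans = mu`_(size mu).-1.
  by rewrite /lambdans /entry -size_mu lam_split nth_cat prednK // leqnn.
have lambda1_mu : lambda1 \in mu by rewrite lambda1E mem_nth.
have lambdans_mu : lambdans \in mu by rewrite lambdansE mem_nth // prednK.
have mu_bounds : {in mu, forall l, lambda1 <= l <= lambdans}.
  move=> l lmu; rewrite -[l](nth_index 0 lmu) lambda1E lambdansE.
  have il : (index l mu < size mu)%N by rewrite index_mem.
  by apply/andP; split; apply: (sorted_leq_nth le_trans lexx) => //;
    rewrite ?inE ?prednK // -ltnS prednK.
have lambdans_lt1 : lambdans < 1 by have /andP[] := mu_itv _ lambdans_mu.
split=> [l0 l1|l0 l1|l0 _].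
- have l01 : 0 < lambdans < 1 by rewrite l0.
  exact: (optimal_full_relaxation phi_le lambdans_mu mu_bounds l01 l1).
- have l01 : 0 < lambdans < 1 by rewrite l0.
  exact: (optimal_reduced_relaxation phi_le lambdans_mu lambda1_mu mu_bounds
    l01 l1).
- exact: (optimal_half_beta phi_le lambdans_mu lambda1_mu mu_bounds l0).
Qed.
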